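(* Let $n\ge 2$ be an integer. Let $\mathcal{X}\subseteq\mathbb{R}^{2n}$ denote the set of vectors $(\theta,\theta_1,\theta_2,\ldots,\theta_{n-1},r,t_1,t_2,\ldots,t_{n-1})$ that, together with $t_n:=\frac{1}{t_1\cdots t_{n-1}}$ and $\theta_n:=2\pi-(\theta_1+\cdots+\theta_{n-1})$, satisfy the constraints \begin{align*} \theta&\in[0,2\pi),\\ \theta_i&\in(\tfrac{\pi}{3},\tfrac{5\pi}{3}) \text{ for every } i\in[n],\\ r&\in(0,\infty),\\ t_i&\in(0,\infty) \text{ for every } i\in[n], \text{ and }\\ t_i&\in(2\cos\theta_i,\tfrac{1}{2\cos\theta_i}) \text{ for every } i\in[n] \text{ such that } \theta_i\in(\tfrac{\pi}{3},\tfrac{\pi}{2})\cup(\tfrac{3\pi}{2},\tfrac{5\pi}{3}). \end{align*} Let $\mathcal{Y}\subseteq(\mathbb{R}^2)^n$ denote the set of $n$-tuples of nonzero points in $\mathbb{R}^2$ that are closer to the origin than to each other and are labeled in counterclockwise order about the origin. Then the map \[ F\colon(\theta,\theta_1,\theta_2,\ldots,\theta_{n-1},r,t_1,t_2,\ldots,t_{n-1})\mapsto(\bm{r}_1,\ldots,\bm{r}_n) \] such that each $\bm{r}_i$ has argument $\theta+\sum_{k=1}^{i-1}\theta_k$ and magnitude $r\prod_{k=1}^{i-1}t_k$ is a bijection $F\colon\mathcal{X}\to\mathcal{Y}$.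
   Context: Here $[n]:=\{1,\ldots,n\}$, and empty sums and products are $0$ and $1$, respectively. The argument of a nonzero point of $\mathbb{R}^2$ is its polar angle, understood modulo $2\pi$, and its magnitude is its Euclidean norm $|\cdot|$; thus $\bm{r}_i=\rho_i(\cos\phi_i,\sin\phi_i)$ with $\rho_i=r\prod_{k=1}^{i-1}t_k$ and $\phi_i=\theta+\sum_{k=1}^{i-1}\theta_k$. Points $\bm{r}_1,\ldots,\bm{r}_n\in\mathbb{R}^2$ are ''closer to the origin than to each other'' if $|\bm{r}_i|<|\bm{r}_i-\bm{r}_j|$ for all $i,j\in[n]$ with $i\ne j$. Nonzero points $\bm{r}_1,\ldots,\bm{r}_n$ are ''labeled in counterclockwise order about the origin'' if one can choose real polar angles $\phi_1,\ldots,\phi_n$ for them such that $\phi_1<\phi_2<\cdots<\phi_n<\phi_1+2\pi$; any of the points may be taken as the first one, so a set of $n$ such points with distinct arguments determines exactly $n$ such $n$-tuples. *)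

(* Defs.v *)
From HB Require Import structures.
From mathcomp Require Import all_boot all_order all_algebra.
From mathcomp Require Import all_classical all_reals all_analysis.

Set Implicit Arguments.
Unset Strict Implicit.
Unset Printing Implicit Defensive.

Import Order.TTheory GRing.Theory Num.Theory.

Local Open Scope classical_set_scope.
Local Open Scope ring_scope.

(* MathComp-Analysis, over an arbitrary R : realType. *)

(* The library norm on R * R is the max norm, so the Euclidean norm is defined
   separately. *)
Definition enorm (R : realType) (p : R * R) : R :=
  Num.sqrt (p.1 ^+ 2 + p.2 ^+ 2).

Definition polar (R : realType) (rho phi : R) : R * R :=
  (rho * cos phi, rho * sin phi).

(* phi is one of the real polar angles of p (for p != 0 it is determined
   modulo 2 * pi). *)
Definition polar_angle (R : realType) (p : R * R) (phi : R) : Prop :=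
  p = polar (enorm p) phi.

(* A parameter vector (theta, theta_1, ..., theta_(n-1), r, t_1, ..., t_(n-1))
   is a (2 * n)-tuple x whose entries, counted from 0, are laid out as
     x`_0 = theta,  x`_i = theta_i,  x`_n = r,  x`_(n + i) = t_i  (0 < i < n).
   The indices i of [angle x i] and [ratio x i] below range over 1, ..., n. *)
Definition base_angle (R : realType) (n : nat) (x : (2 * n).-tuple R) : R :=
  x`_0.

Definition angle (R : realType) (n : nat) (x : (2 * n).-tuple R) (i : nat) :
    R :=
  if (i < n)%N then x`_i else 2 * pi - \sum_(1 <= k < n) x`_k.

Definition base_radius (R : realType) (n : nat) (x : (2 * n).-tuple R) : R :=
  x`_n.

Definition ratio (R : realType) (n : nat) (x : (2 * n).-tuple R) (i : nat) :
    R :=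
  if (i < n)%N then x`_(n + i) else 1 / \prod_(1 <= k < n) x`_(n + k).

Definition param_set (R : realType) (n : nat) : set ((2 * n).-tuple R) :=
  [set x |
  [/\ 0 <= base_angle x < 2 * pi,
      forall i, (1 <= i <= n)%N -> pi / 3 < angle x i < 5 * pi / 3,
      0 < base_radius x,
      forall i, (1 <= i <= n)%N -> 0 < ratio x i
    & forall i, (1 <= i <= n)%N ->
        pi / 3 < angle x i < pi / 2 \/ 3 * pi / 2 < angle x i < 5 * pi / 3 ->
        2 * cos (angle x i) < ratio x i < 1 / (2 * cos (angle x i))]].

(* Entry i (counted from 0) of the image is the point r_(i + 1). *)
Definition param_map (R : realType) (n : nat) (x : (2 * n).-tuple R) :
    n.-tuple (R * R) :=
  [tuple polar (base_radius x * \prod_(1 <= k < i.+1) ratio x k)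
               (base_angle x + \sum_(1 <= k < i.+1) angle x k) | i < n].

Definition closer_to_origin (R : realType) (n : nat) (y : n.-tuple (R * R)) :
    Prop :=
  forall i j : 'I_n, i != j -> enorm (tnth y i) < enorm (tnth y i - tnth y j).

Definition ccw_labeled (R : realType) (n : nat) (y : n.-tuple (R * R)) :
    Prop :=
  exists phi : n.-tuple R,
    [/\ forall i : 'I_n, polar_angle (tnth y i) (tnth phi i),
        sorted <%R phi
      & phi`_n.-1 < phi`_0 + 2 * pi].

Definition point_set (R : realType) (n : nat) : set (n.-tuple (R * R)) :=
  [set y |
  [/\ forall i : 'I_n, tnth y i != 0, closer_to_origin y & ccw_labeled y]].

(* Main.v *)
(* For points with polar coordinates (a, t) and (b, u), the law of cosines turns
   a < |p - q| into 2 cos (t - u) a < b.  For cyclically adjacent points this is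
   2 cos theta_i < t_i and 2 cos theta_i t_i < 1; since one of t_i, 1 / t_i is
   at most 1 this forces cos theta_i < 1 / 2, i.e. theta_i in ]pi / 3, 5 pi / 3[,
   and it is then a condition on t_i only where cos theta_i > 0.  Conversely, if
   all theta_i exceed pi / 3, nonadjacent points are seen from the origin at
   angles in [2 pi / 3, 4 pi / 3], where the cosine is negative, so they impose
   nothing. *)
Require Import Defs.
From mathcomp Require Import all_boot all_order all_algebra.
From mathcomp Require Import all_classical all_reals all_analysis.
From mathcomp Require Import ring lra zify.

Set Implicit Arguments.
Unset Strict Implicit.
Unset Printing Implicit Defensive.

Import Defs Order.TTheory GRing.Theory Num.Theory.

Local Open Scope ring_scope.

(** * Periodicity and trigonometric inequalities *)

Lemma periodicz (U V : zmodType) (f : U -> V) (T : U) :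
  periodic f T -> forall (m : int) a, f (a + T *~ m) = f a.
Proof.
move=> fT [m|m] a; first exact: (periodicn fT).
by rewrite -(periodicn fT m.+1) NegzE mulrNz subrK.
Qed.

Section trigonometry.
Context {R : realType}.
Implicit Types t u a b : R.

Lemma cos_2piB t : cos (2 * pi - t) = cos t.
Proof. by rewrite -cosN opprB mulr_natl -cosD2pi subrK. Qed.

(** Cosine decreases on [0, pi]; an angle beyond pi is reflected to [2 * pi - t]. *)
Lemma ltr_cos_arc a t : 0 <= a <= pi -> 0 <= t <= 2 * pi ->
  (cos t < cos a) = (a < t < 2 * pi - a).
Proof.
move=> ha ht; have [tpi|tpi] := leP t pi.
  by rewrite ltr_cos ?in_itv//=; lra.
by rewrite -cos_2piB ltr_cos ?in_itv//=; lra.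
Qed.

Lemma ltl_cos_arc a t : 0 <= a <= pi -> 0 <= t <= 2 * pi ->
  (cos a < cos t) = (t < a) || (2 * pi - a < t).
Proof.
move=> ha ht; have [tpi|tpi] := leP t pi.
  by rewrite ltr_cos ?in_itv//=; lra.
by rewrite -(cos_2piB t) ltr_cos ?in_itv//=; lra.
Qed.

(* The triple angle formula at pi/3 reads (c + 1) (2 c - 1) ^ 2 = 0. *)
Lemma cos_pi3 : cos (pi / 3) = 1 / 2 :> R.
Proof.
have pi0 := pi_gt0 R; set c := cos (pi / 3).
have c0 : 0 < c by apply: cos_gt0_pihalf; lra.
have E : cos (pi / 3 + pi / 3 *+ 2) = -1 :> R.
  by rewrite -cospi; congr cos; lra.
move: E; rewrite cosD cos_mulr2n sin_mulr2n -/c mulrnAr mulrCA -expr2 sin2cos2.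
rewrite -/c => E.
have : (c + 1) * (2 * c - 1) ^+ 2 == 0 by apply/eqP; lra.
by rewrite mulf_eq0 sqrf_eq0 => /orP[] /eqP; lra.
Qed.

(** The hypotheses give [cos (t - u) = 1], which below a full turn happens only at 0. *)
Lemma eq_angle t u : cos t = cos u -> sin t = sin u -> `|t - u| < 2 * pi ->
  t = u.
Proof.
move=> ec es tu; have pi0 := pi_gt0 R.
have : ~~ (cos `|t - u| < cos 0).
  by rewrite cos_norm cosB ec es -!expr2 cos2Dsin2 cos0 ltxx.
rewrite ltr_cos_arc ?normr_ge0 ?lexx ?(ltW pi0) ?(ltW tu)// subr0 tu andbT.
by rewrite normr_gt0 subr_eq0 negbK => /eqP.
Qed.

Lemma angle_ratioP t a : 0 < t <= 2 * pi -> 0 < a ->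
  (2 * cos t < a /\ 2 * cos t * a < 1) <->
  (pi / 3 < t < 5 * pi / 3 /\
   (pi / 3 < t < pi / 2 \/ 3 * pi / 2 < t < 5 * pi / 3 ->
    2 * cos t < a < 1 / (2 * cos t))).
Proof.
move=> ht a0; have pi0 := pi_gt0 R.
have arc3 : (cos t < 1 / 2) = (pi / 3 < t < 5 * pi / 3).
  by rewrite -cos_pi3 ltr_cos_arc; lra.
have arc2 : (0 < cos t) = (t < pi / 2) || (3 * pi / 2 < t).
  by rewrite -cos_pihalf ltl_cos_arc; lra.
rewrite -arc3; split=> [[h1 h2]|[h3 h4]].
  (* If [1 / 2 <= cos t], the two inequalities would give [1 < a] and [a < 1]. *)
  split; first by nra.
  move=> h; have c0 : 0 < cos t by rewrite arc2; lra.
  by rewrite h1 ltr_pdivlMr; lra.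
have [c0|c0] := leP (cos t) 0; first by split; nra.
have {h4} : 2 * cos t < a < 1 / (2 * cos t) by apply: h4; lra.
by rewrite ltr_pdivlMr; lra.
Qed.

End trigonometry.

(** * Polar coordinates and the law of cosines *)

Section polar.
Context {R : realType}.
Implicit Types (p : R * R) (a b t u : R).

Lemma enorm_polar a t : 0 <= a -> enorm (polar a t) = a.
Proof.
move=> a0; rewrite /enorm /= !exprMn -mulrDr cos2Dsin2 mulr1 sqrtr_sqr.
exact: ger0_norm.
Qed.

Lemma enorm_eq0 p : (enorm p == 0) = (p == 0).
Proof.
case: p => a b; rewrite /enorm /= sqrtr_eq0 le_eqVlt ltNge.
by rewrite addr_ge0 ?sqr_ge0//= orbF paddr_eq0 ?sqr_ge0// !sqrf_eq0.
Qed.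

Lemma enorm_gt0 p : (0 < enorm p) = (p != 0).
Proof. by rewrite -enorm_eq0 lt_def sqrtr_ge0 andbT. Qed.

Lemma polar_neq0 a t : 0 < a -> polar a t != 0.
Proof. by move=> a0; rewrite -enorm_gt0 enorm_polar ?ltW. Qed.

(** The squared distance is [a ^+ 2 + b * (b - 2 * cos (t - u) * a)], so with [b] positive only the
    sign of the second factor matters. *)
Lemma lt_enorm_polarB a b t u : 0 < a -> 0 < b ->
  (a < enorm (polar a t - polar b u)) = (2 * cos (t - u) * a < b).
Proof.
move=> a0 b0; rewrite -{1}(ger0_norm (ltW a0)) -sqrtr_sqr /enorm.
set s := (X in _ < Num.sqrt X).
have -> : s = a ^+ 2 + b * (b - 2 * cos (t - u) * a).
  transitivity (a ^+ 2 * (cos t ^+ 2 + sin t ^+ 2) +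
                b ^+ 2 * (cos u ^+ 2 + sin u ^+ 2) -
                2 * a * b * (cos t * cos u + sin t * sin u)).
    by rewrite /s /=; ring.
  by rewrite !cos2Dsin2 -cosB; ring.
set d := b - _; have [d0|d0] := ltP 0 d.
  rewrite ltr_sqrt; last by rewrite ltr_wpDl ?sqr_ge0// mulr_gt0.
  by rewrite ltrDl mulr_gt0// -subr_gt0 d0.
rewrite [RHS]ltNge -subr_le0 d0/=; apply/negbTE; rewrite -leNgt ler_wsqrtr//.
by rewrite gerDl pmulr_rle0.
Qed.

End polar.

(** * Points as partial sums and products of the parameters *)

Section param_points.
Context {R : realType} {n : nat}.
Implicit Type x : (2 * n).-tuple R.

(* The point r_(i + 1) for i < n; at i = n these are again polar coordinates
   of r_1. *)
Definition point_angle x i : R :=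
  base_angle x + \sum_(1 <= k < i.+1) angle x k.

Definition point_radius x i : R :=
  base_radius x * \prod_(1 <= k < i.+1) ratio x k.

Lemma tnth_param_map x i :
  tnth (param_map x) i = polar (point_radius x i) (point_angle x i).
Proof. exact: tnth_mktuple. Qed.

Lemma point_angle0 x : point_angle x 0 = base_angle x.
Proof. by rewrite /point_angle big_geq ?addr0. Qed.

Lemma point_angleS x i : point_angle x i.+1 = point_angle x i + angle x i.+1.
Proof. by rewrite /point_angle big_nat_recr//= addrA. Qed.

(** [angle x n] is what the other angles leave of a full turn. *)
Lemma point_angle_last x : (0 < n)%N ->
  point_angle x n = point_angle x 0 + 2 * pi.
Proof.
move=> n0; rewrite point_angle0 /point_angle big_nat_recr//=.
rewrite {2}/angle ltnn (eq_big_nat _ _ (F2 := fun k => x`_k)).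
  by rewrite subrKC.
by move=> k /andP[_ kn]; rewrite /angle kn.
Qed.

Lemma point_radius0 x : point_radius x 0 = base_radius x.
Proof. by rewrite /point_radius big_geq ?mulr1. Qed.

Lemma point_radiusS x i : point_radius x i.+1 = point_radius x i * ratio x i.+1.
Proof. by rewrite /point_radius big_nat_recr//= mulrA. Qed.

(** The hypothesis makes the product inverted in [ratio x n] nonzero; all [n] ratios then multiply
    to 1. *)
Lemma point_radius_last x : (0 < n)%N -> point_radius x n.-1 != 0 ->
  point_radius x n = point_radius x 0.
Proof.
move=> n0; rewrite point_radius0 /point_radius prednK// big_nat_recr//=.
rewrite {3}/ratio ltnn (eq_big_nat _ _ (F2 := fun k => x`_(n + k))).
  by rewrite mulf_eq0 negb_or => /andP[_ p0]; rewrite div1r divff ?mulr1.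
by move=> k /andP[_ kn]; rewrite /ratio kn.
Qed.

(** Differences of [phi] and quotients of [rho] telescope back to the prescribed values. *)
Lemma param_exists (phi rho : nat -> R) : (0 < n)%N ->
  (forall i, (i < n)%N -> 0 < rho i) ->
  exists x, forall i, (i < n)%N ->
    point_angle x i = phi i /\ point_radius x i = rho i.
Proof.
move=> n0 rho0.
pose F i := if i == 0%N then phi 0%N else if (i < n)%N then phi i - phi i.-1
  else if i == n then rho 0%N else rho (i - n)%N / rho (i - n).-1%N.
exists [tuple F i | i < 2 * n].
have xE i : (i < 2 * n)%N -> [tuple F i | i < 2 * n]`_i = F i.
  by move=> hi; rewrite (nth_mktuple F 0 (Ordinal hi)).
elim=> [_|i IH iSn].
  rewrite point_angle0 point_radius0 /base_angle /base_radius !xE /F; try lia.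
  by rewrite /= ltnn eqxx gtn_eqF.
rewrite point_angleS point_radiusS; have [-> ->] := IH (ltnW iSn).
rewrite /angle /ratio iSn !xE /F ?iSn; try lia.
rewrite !ifN; try lia.
rewrite addKn /= subrKC mulrCA divff ?mulr1//.
by rewrite gt_eqF ?rho0 ?(ltnW iSn).
Qed.

End param_points.

(** * Closeness to the origin in terms of the parameters *)

Section param_set.
Context {R : realType} {n : nat}.
Implicit Type x : (2 * n).-tuple R.

Lemma closer_param_mapE x : (forall i, (i < n)%N -> 0 < point_radius x i) ->
  closer_to_origin (param_map x) <->
  forall i j : 'I_n, i != j ->
    2 * cos (point_angle x i - point_angle x j) * point_radius x i <
    point_radius x j.
Proof.
move=> rho0.
by split=> H i j /H; rewrite !tnth_param_map enorm_polar ?ltW ?rho0//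
  lt_enorm_polarB ?rho0.
Qed.

Context (n2 : (2 <= n)%N).

(** Rests on positivity alone, so that it also applies where the arc constraints are yet to be
    derived. *)
Lemma param_positive x : 0 < base_radius x ->
    (forall i, (1 <= i <= n)%N -> 0 < angle x i) ->
    (forall i, (1 <= i <= n)%N -> 0 < ratio x i) ->
  [/\ {in [pred i | (i <= n)%N] &,
        {homo point_angle x : i j / (i < j)%N >-> i < j}},
      forall i, (1 <= i <= n)%N -> angle x i < 2 * pi,
      forall i, (i <= n)%N -> 0 < point_radius x i &
      point_radius x n = point_radius x 0].
Proof.
move=> r0 th0 t0.
have phi_lt i j : (j <= n)%N -> (i < j)%N -> point_angle x i < point_angle x j.
  elim: j => // j IH jn; rewrite ltnS leq_eqVlt point_angleS => /predU1P[->|ij].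
    by rewrite ltrDl th0.
  by rewrite (lt_trans (IH (ltnW jn) ij))// ltrDl th0.
have rho0 i : (i <= n)%N -> 0 < point_radius x i.
  elim: i => [|i IH] ni; first by rewrite point_radius0.
  by rewrite point_radiusS mulr_gt0 ?IH ?t0// ltnW.
split=> //.
- by move=> i j _ jn; apply: phi_lt.
- case=> // i /= ni; have := point_angleS x i.
  have := point_angle_last x (ltnW n2).
  have : point_angle x 0 <= point_angle x i.
    by case: i ni => // i ni; rewrite ltW// phi_lt// ltnW.
  have : point_angle x i.+1 <= point_angle x n.
    by move: ni; rewrite leq_eqVlt => /predU1P[->//|ni]; rewrite ltW// phi_lt.
  (* As [n] is at least 2, the turn contains another positive angle, before or after this one. *)
  suff : point_angle x 0 < point_angle x i \/
         point_angle x i.+1 < point_angle x n by lra.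
  case: i ni => [|i] ni; last by left; rewrite phi_lt// ltnW.
  by right; rewrite phi_lt.
- by rewrite point_radius_last ?gt_eqF ?rho0 ?leq_pred// ltnW.
Qed.

Lemma closer_adjacent x : 0 < base_radius x ->
    (forall i, (1 <= i <= n)%N -> 0 < angle x i) ->
    (forall i, (1 <= i <= n)%N -> 0 < ratio x i) ->
  closer_to_origin (param_map x) <->
  forall i, (1 <= i <= n)%N ->
    2 * cos (angle x i) < ratio x i /\ 2 * cos (angle x i) * ratio x i < 1.
Proof.
move=> r0 th0 t0; have pi0 := pi_gt0 R.
have [phi_lt th_lt rho0 rho_n] := param_positive r0 th0 t0.
have n0 : (0 < n)%N := ltnW n2.
have phi_n := point_angle_last x n0.
(* This includes [i = n - 1], where index [n] stands for the first point again. *)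
have adjE i : (i < n)%N ->
  (2 * cos (point_angle x i.+1 - point_angle x i) * point_radius x i <
     point_radius x i.+1 /\
   2 * cos (point_angle x i.+1 - point_angle x i) * point_radius x i.+1 <
     point_radius x i) <->
  (2 * cos (angle x i.+1) < ratio x i.+1 /\
   2 * cos (angle x i.+1) * ratio x i.+1 < 1).
  move=> ni; rewrite point_angleS addrC addKr point_radiusS.
  rewrite (mulrC (point_radius x i)) ltr_pM2r ?rho0 1?ltnW// mulrA.
  by rewrite gtr_pMl// rho0 1?ltnW.
have cosBC a b : cos (a - b) = cos (b - a) :> R by rewrite -cosN opprB.
have cos_last a : cos (point_angle x n - a) = cos (point_angle x 0 - a).
  by rewrite phi_n addrAC mulr_natl cosD2pi.
rewrite closer_param_mapE; last by move=> i /ltnW; apply: rho0.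
split=> [H [//|i] /= ni|H].
  apply/adjE => //.
  (* The cyclic successor of [i]. *)
  pose k := if i.+1 == n then 0%N else i.+1.
  have kn : (k < n)%N by rewrite /k; case: ifP; lia.
  have := H (Ordinal ni) (Ordinal kn); have := H (Ordinal kn) (Ordinal ni).
  rewrite -!val_eqE /= {1 3}/k.
  have -> : point_radius x k = point_radius x i.+1.
    by rewrite /k; case: eqP => [->|].
  rewrite (cosBC (point_angle x i)).
  have -> : cos (point_angle x k - point_angle x i) =
            cos (point_angle x i.+1 - point_angle x i).
    by rewrite /k; case: eqP => [->|//]; rewrite cos_last.
  by move=> h1 h2; split; [apply: h2|apply: h1]; rewrite /k; case: ifP; lia.
have third i : (1 <= i <= n)%N -> pi / 3 < angle x i.
  move=> hi; have ht : 0 < angle x i <= 2 * pi by rewrite th0// ltW ?th_lt.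
  by have [/andP[]] := (angle_ratioP ht (t0 _ hi)).1 (H i hi).
have phi_le i j : (i <= j <= n)%N ->
  point_angle x i + pi / 3 *+ (j - i) <= point_angle x j.
  elim: j => [|j IH] ij; first by rewrite sub0n addr0; case: i ij.
  have [->|ij'] := eqVneq i j.+1; first by rewrite subnn addr0.
  have /IH {}IH : (i <= j <= n)%N by lia.
  rewrite subSn; last lia.
  have : pi / 3 < angle x j.+1 by apply: third; lia.
  by rewrite point_angleS (mulrSr (pi / 3)); lra.
suff ordered i j : (i < j < n)%N ->
    2 * cos (point_angle x j - point_angle x i) * point_radius x i <
      point_radius x j /\
    2 * cos (point_angle x j - point_angle x i) * point_radius x j <
      point_radius x i.
  move=> i j; rewrite -val_eqE neq_ltn => /orP[] ij.
    by rewrite cosBC; apply: (ordered _ _ _).1; rewrite ij /=.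
  by apply: (ordered _ _ _).2; rewrite ij /=.
(* Three cases: consecutive indices, the first and last points, and nonadjacent points. *)
move=> /andP[ij jn]; have [ji|ji] := eqVneq j i.+1.
  by rewrite ji in jn *; apply/adjE; [lia|apply: H; lia].
have [/andP[/eqP i0 /eqP jl]|il] := boolP ((i == 0%N) && (j.+1 == n)).
  have [h1 h2] := (adjE _ jn).2 (H j.+1 jn).
  by move: h1 h2; rewrite jl i0 cos_last rho_n (cosBC (point_angle x j)).
have c0 : cos (point_angle x j - point_angle x i) < 0.
  have le2 m : (2 <= m)%N -> pi / 3 *+ 2 <= pi / 3 *+ m :> R.
    by move=> m2; rewrite ler_wpMn2l//; lra.
  have lo : pi / 3 *+ 2 <= point_angle x j - point_angle x i.
    have hj : (i <= j <= n)%N by lia.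
    have /le2 : (2 <= j - i)%N by lia.
    by have := phi_le _ _ hj; lra.
  (* Going on from [j] through [n] back to [i] takes [i + (n - j)] steps, at least 2 in this
     case. *)
  have hi : point_angle x j - point_angle x i <= 2 * pi - pi / 3 *+ 2.
    have hi : (0 <= i <= n)%N by lia.
    have hj : (j <= n <= n)%N by lia.
    have /le2 : (2 <= i - 0 + (n - j))%N by lia.
    by rewrite mulrnDr; have := phi_le _ _ hi; have := phi_le _ _ hj; lra.
  by rewrite -cos_pihalf ltr_cos_arc; lra.
have ri : 0 < point_radius x i by apply: rho0; lia.
by have := rho0 _ (ltnW jn); split; nra.
Qed.

(** Trades the arc and ratio-interval constraints for closeness of the image, the condition that
    [point_set] itself imposes. *)
Lemma param_setE x : param_set x <->
  [/\ 0 <= base_angle x < 2 * pi,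
      forall i, (1 <= i <= n)%N -> 0 < angle x i,
      0 < base_radius x,
      forall i, (1 <= i <= n)%N -> 0 < ratio x i &
      closer_to_origin (param_map x)].
Proof.
have pi0 := pi_gt0 R; split.
  move=> [hb th_in r0 t0 cond].
  have th0 i : (1 <= i <= n)%N -> 0 < angle x i by move=> /th_in; lra.
  split=> //; apply/closer_adjacent => // i hi.
  by apply/angle_ratioP; [have := th_in i hi; lra|exact: t0|split; auto].
move=> [hb th0 r0 t0 cl]; have [_ th_lt _ _] := param_positive r0 th0 t0.
have eqv i (hi : (1 <= i <= n)%N) : 0 < angle x i <= 2 * pi.
  by rewrite th0// ltW// th_lt.
have adj i (hi : (1 <= i <= n)%N) :=
  (angle_ratioP (eqv i hi) (t0 i hi)).1 ((closer_adjacent r0 th0 t0).1 cl i hi).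
by split=> // i hi; [apply: (adj i hi).1|apply: (adj i hi).2].
Qed.

(** * Image, injectivity and surjectivity of the map *)

Lemma param_map_point_set x : param_set x -> point_set (param_map x).
Proof.
move=> /param_setE[_ th0 r0 t0 cl].
have [phi_lt _ rho0 _] := param_positive r0 th0 t0.
have n0 : (0 < n)%N := ltnW n2.
have inE' i : (i < n)%N -> [tuple point_angle x i | i < n]`_i = point_angle x i.
  by move=> hi; rewrite (nth_mktuple _ 0 (Ordinal hi)).
split=> //.
  by move=> i; rewrite tnth_param_map polar_neq0// rho0// ltnW.
exists [tuple point_angle x i | i < n]; split.
- move=> i; rewrite /polar_angle tnth_param_map tnth_mktuple enorm_polar//.
  by rewrite ltW// rho0// ltnW.
- apply/(sortedP 0) => i; rewrite size_tuple => iSn.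
  by rewrite !inE' ?(ltnW iSn)//; apply: phi_lt; rewrite ?inE// ltnW// ltnW.
(* The closing inequality is monotonicity from [n - 1] to [n], where the angle is a full turn past
   the first. *)
- rewrite !inE' ?prednK// -point_angle_last//.
  by apply: phi_lt; rewrite ?inE ?leq_pred// prednK.
Qed.

(** Norms give the radii. The base angles of two preimages, and then their successive angles, differ
    by less than 2 pi, so equal directions force equal angles by induction. *)
Lemma param_map_inj : set_inj (@param_set R n) (@param_map R n).
Proof.
have n0 : (0 < n)%N := ltnW n2.
have pi0 := pi_gt0 R.
move=> x x' /set_mem Xx /set_mem Xx' xx'.
have [hb hth _ _ _] := Xx; have [hb' hth' _ _ _] := Xx'.
have /param_setE[_ th0 r0 t0 _] := Xx.
have /param_setE[_ th0' r0' t0' _] := Xx'.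
have [_ _ rho0 _] := param_positive r0 th0 t0.
have [_ _ rho0' _] := param_positive r0' th0' t0'.
have polE i : (i < n)%N ->
    polar (point_radius x i) (point_angle x i) =
    polar (point_radius x' i) (point_angle x' i).
  move=> hi; have := congr1 (fun y => tnth y (Ordinal hi)) xx'.
  by rewrite !tnth_param_map.
have rhoE i : (i < n)%N -> point_radius x i = point_radius x' i.
  move=> hi; have /(congr1 (@enorm R)) := polE i hi.
  by rewrite !enorm_polar// ltW// (rho0, rho0')// ltnW.
have angE i : (i < n)%N -> `|point_angle x i - point_angle x' i| < 2 * pi ->
    point_angle x i = point_angle x' i.
  move=> hi; have := polE i hi; rewrite rhoE// => -[].
  have ri : point_radius x' i != 0 by rewrite gt_eqF// rho0'// ltnW.
  by move=> /(mulfI ri) ec /(mulfI ri) es; apply: eq_angle.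
have phiE i : (i < n)%N -> point_angle x i = point_angle x' i.
  elim: i => [|i IH] hi; apply: angE => //.
    by rewrite !point_angle0 ltr_norml; lra.
  have hi' : (1 <= i.+1 <= n)%N := ltnW hi.
  rewrite !point_angleS IH 1?ltnW// ltr_norml.
  by have := hth _ hi'; have := hth' _ hi'; lra.
apply/val_inj/(eq_from_nth (x0 := 0)) => [|k]; first by rewrite !size_tuple.
rewrite size_tuple => hk.
(* An entry is the base angle, the base radius, or a difference or quotient of consecutive angles or
   radii. *)
have [k0|k0] := posnP k.
  by have := phiE _ n0; rewrite !point_angle0 k0.
have [kn|kn|->] := ltngtP k n; last first.
- by have := rhoE _ n0; rewrite !point_radius0.
- have [l [l0 ln ->]] : exists l, [/\ (0 < l)%N, (l < n)%N & k = (n + l)%N].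
    by exists (k - n)%N; split; lia.
  have ratioE (z : (2 * n).-tuple R) : z`_(n + l) = ratio z l.
    by rewrite /ratio ln.
  have rl : point_radius x l.-1 != 0 by rewrite gt_eqF// rho0//; lia.
  rewrite !ratioE -(prednK l0); apply: (mulfI rl).
  have ln' : (l.-1 < n)%N by lia.
  by rewrite [in RHS]rhoE// -!point_radiusS prednK// rhoE.
- have angleE (z : (2 * n).-tuple R) : z`_k = angle z k by rewrite /angle kn.
  rewrite !angleE -(prednK k0); apply: (addrI (point_angle x k.-1)).
  have kn' : (k.-1 < n)%N by lia.
  by rewrite [in RHS]phiE// -!point_angleS prednK// phiE.
Qed.

(** The labeling angles are shifted by whole turns and passed, with the norms, to [param_exists]. *)
Lemma param_map_surj :
  set_surj (@param_set R n) (@point_set R n) (@param_map R n).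
Proof.
have n0 : (0 < n)%N := ltnW n2.
have pi0 := pi_gt0 R.
move=> y [y0 cl [phi [phiP phi_sorted phi_last]]].
(* Subtracting [m] turns brings the first angle into [0, 2 pi[. *)
pose m := Num.floor (phi`_0 / (2 * pi)).
pose rho i := enorm y`_i.
pose psi i := phi`_i + pi *+ 2 *~ - m.
have y_tnth (i : 'I_n) : y`_i = tnth y i by rewrite (tnth_nth 0).
have rho0 i : (i < n)%N -> 0 < rho i.
  by move=> hi; rewrite /rho enorm_gt0 (y_tnth (Ordinal hi)).
have [x xE] := param_exists psi n0 rho0.
have phixE i (hi : (i < n)%N) := (xE i hi).1.
have rhoxE i (hi : (i < n)%N) := (xE i hi).2.
have xy : param_map x = y.
  apply: eq_from_tnth => i; rewrite tnth_param_map phixE// rhoxE//.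
  rewrite [RHS]phiP /rho y_tnth /polar /psi.
  by rewrite (periodicz (@cosD2pi R)) (periodicz (@sinD2pi R)) (tnth_nth 0 phi).
have radius_last : point_radius x n = point_radius x 0.
  by apply: point_radius_last => //; rewrite rhoxE ?gt_eqF ?rho0// prednK.
have rhox0 i : (i <= n)%N -> 0 < point_radius x i.
  rewrite leq_eqVlt => /predU1P[->|hi]; last by rewrite rhoxE ?rho0.
  by rewrite radius_last rhoxE ?rho0.
exists x => //; apply/param_setE; split.
- rewrite -point_angle0 phixE// /psi mulrNz -mulrzr -(mulr_natl pi 2).
  have := floor_itv (phi`_0 / (2 * pi)); rewrite -/m.
  have pi2 : 0 < 2 * pi :> R by lra.
  by rewrite ler_pdivlMr// ltr_pdivrMr// intrD; lra.
- case=> // i /= hi; rewrite -(ltrDl (point_angle x i)) -point_angleS.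
  have [iSn|iSn] := ltnP i.+1 n.
    rewrite !phixE// /psi ltrD2r.
    by move/(sortedP 0): phi_sorted; apply; rewrite size_tuple.
  (* The last angle is positive because the labeling ends less than a full turn after it starts. *)
  have -> : i = n.-1 by lia.
  rewrite prednK// point_angle_last// !phixE ?prednK// /psi; lra.
- by rewrite -point_radius0 rhox0.
- case=> // i /= hi; rewrite -(pmulr_rgt0 _ (rhox0 i (ltnW hi))).
  by rewrite -point_radiusS rhox0.
- by rewrite xy.
Qed.

End param_set.

Theorem lemma2 (R : realType) (n : nat) (hn : (2 <= n)%N) :
  set_bij (@param_set R n) (@point_set R n) (@param_map R n).
Proof.
split; first exact: param_map_point_set.
- exact: param_map_inj.
- exact: param_map_surj.
Qed.
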